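(* The class of MF spaces is closed under arbitrary topological products: for every family $(P_i)_{i\in I}$ of posets there is a poset $P$ such that the product space $\prod_{i\in I}\mathrm{MF}(P_i)$ (with the product topology) is homeomorphic to $\mathrm{MF}(P)$.
   Context: A poset is a set $P$ with a reflexive, antisymmetric, transitive relation $\preceq$. A filter on $P$ is a nonempty subset $F\subseteq P$ such that (1) for all $p,q\in F$ there is $r\in F$ with $r\preceq p$ and $r\preceq q$, and (2) if $p\in F$, $q\in P$ and $p\preceq q$ then $q\in F$. A filter is maximal if no strictly larger filter contains it. $\mathrm{MF}(P)$ is the set of maximal filters on $P$, with the topology having basis $\{N_p : p\in P\}$, where $N_p=\{F\in \mathrm{MF}(P) : p\in F\}$. An MF space is a space of the form $\mathrm{MF}(P)$ (up to homeomorphism). *)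

(* Defs.v *)
From HB Require Import structures.
From mathcomp Require Import all_boot all_order all_classical topology.

Set Implicit Arguments.
Unset Strict Implicit.
Unset Printing Implicit Defensive.

Import Order.POrderTheory.
Local Open Scope classical_set_scope.
Local Open Scope order_scope.

(* Distinct from the [Filter] of mathcomp.classical.filter, whose members are
   subsets of a type rather than elements of a poset. *)
Definition poset_filter (d : Order.disp_t) (P : porderType d) (F : set P) :=
  [/\ F !=set0,
      forall p q, F p -> F q -> exists r, [/\ F r, r <= p & r <= q]
    & forall p q, F p -> p <= q -> F q].

Definition maximal_filter (d : Order.disp_t) (P : porderType d) (F : set P) :=
  poset_filter F /\ forall G : set P, poset_filter G -> ~ (F `<` G).

Definition MF (d : Order.disp_t) (P : porderType d) : Type :=
  set_type [set F : set P | maximal_filter F].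

HB.instance Definition _ (d : Order.disp_t) (P : porderType d) :=
  Choice.copy (MF P) (set_type [set F : set P | maximal_filter F]).

Definition MF_nbr (d : Order.disp_t) (P : porderType d) (p : P) : set (MF P) :=
  [set F | (set_val F : set P) p].

Section MFTopology.
Context (d : Order.disp_t) (P : porderType d).

Lemma MF_filter (F : MF P) : maximal_filter (set_val F).
Proof. by have := valP F; rewrite inE. Qed.

Let MF_cover : \bigcup_(U in range (@MF_nbr _ P)) U = [set: MF P].
Proof.
apply/seteqP; split=> // F _.
by have [[[p Fp] _ _] _] := MF_filter F; exists (MF_nbr p) => //; exists p.
Qed.

Let MF_join (U V : set (MF P)) (F : MF P) :
  range (@MF_nbr _ P) U -> range (@MF_nbr _ P) V -> U F -> V F ->
  exists W, [/\ range (@MF_nbr _ P) W, W F & W `<=` U `&` V].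
Proof.
move=> [p _ <-] [q _ <-] Fp Fq.
have [[_ Fdir _] _] := MF_filter F; have [r [Fr rp rq]] := Fdir p q Fp Fq.
exists (MF_nbr r); split=> //.
move=> G Gr; have [[_ _ Gup] _] := MF_filter G.
by split; [exact: Gup Gr rp|exact: Gup Gr rq].
Qed.

(* The base is indexed by itself, rather than by [P], because [P] may be
   empty while [isBaseTopological] asks for a pointed type of indices. *)
HB.instance Definition _ := isBaseTopological.Build (MF P) MF_cover MF_join.

Lemma MF_basis : basis (range (@MF_nbr _ P)).
Proof.
split=> [U NU|F A].
  by exists [set U] => [V ->//|]; rewrite bigcup_set1.
rewrite /= nbhsE => -[B [[D DN <-] [U DU UF]] BA].
exists U; first by split; [exact: DN|].
by move=> x Ux; apply: BA; exists U.
Qed.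

End MFTopology.

Definition homeomorphic (X Y : topologicalType) :=
  exists (f : X -> Y) (g : Y -> X),
    [/\ cancel f g, cancel g f, continuous f & continuous g].

(* Main.v *)
(** Let [Q] consist of the finite partial choices [q] of elements [q i : P i],
    ordered pointwise, with a larger domain giving a smaller element.  A family
    [F] of filters on the [P i] gives the filter [box F] on [Q], and a filter
    [G] on [Q] lies in the box of its slices.  These two constructions restrict
    to mutually inverse bijections between families of maximal filters and
    maximal filters.  In particular no slice of a maximal [G] is empty: an empty
    slice could be replaced by any filter on [P i], and the box of the resulting
    family would strictly contain [G]. *)
From HB Require Import structures.
Require Import Defs.
From mathcomp Require Import all_boot all_order finmap all_classical topology.

Set Implicit Arguments.
Unset Strict Implicit.
Unset Printing Implicit Defensive.

Import Order.POrderTheory.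
Local Open Scope classical_set_scope.
Local Open Scope order_scope.

(** * Filters on a poset and basic neighbourhoods *)

Lemma maximal_filter_eq (d : Order.disp_t) (P : porderType d) (F G : set P) :
  maximal_filter F -> poset_filter G -> F `<=` G -> F = G.
Proof.
move=> [_ Fmax] Gfilter FG; apply: contrapT => FNG.
by apply: (Fmax G Gfilter); rewrite properEneq; split=> //; apply/eqP.
Qed.

Lemma principal_filter (d : Order.disp_t) (P : porderType d) (p : P) :
  poset_filter [set x | p <= x].
Proof.
split; first by exists p => /=.
- by move=> x y px py; exists p; split=> /=.
- by move=> x y px xy; exact: le_trans px xy.
Qed.

Lemma MF_valK (d : Order.disp_t) (P : porderType d) (F G : MF P) :
  set_val F = set_val G -> F = G.
Proof. exact: val_inj. Qed.

Definition MF_of (d : Order.disp_t) (P : porderType d) (F : set P)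
  (Fmax : maximal_filter F) : MF P := SigSub (mem_set Fmax).

Lemma open_MF_nbr (d : Order.disp_t) (P : porderType d) (p : P) :
  open (MF_nbr p).
Proof. by have [+ _] := MF_basis P; apply; exists p. Qed.

Lemma nbhs_MF (d : Order.disp_t) (P : porderType d) (F : MF P) (A : set (MF P)) :
  nbhs F A -> exists2 p, set_val F p & MF_nbr p `<=` A.
Proof.
by have [_ /[apply] [[_ /= [[p _ <-] Fp] pA]]] := MF_basis P; exists p.
Qed.

(** * The poset of finite conditions *)

Section FiniteConditions.
Context (I : choiceType) (d : I -> Order.disp_t)
  (P : forall i : I, porderType (d i)).

(* [cond_inh] leaves no condition when some factor is empty, as the product of
   the [MF (P i)] is then empty, while the empty condition would be a point. *)
Record condition := Condition {
  cond_fun :> forall i, option (P i);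
  cond_fin : finite_set [set i | cond_fun i];
  cond_inh : forall i, inhabited (P i) }.

HB.instance Definition _ := gen_eqMixin condition.
HB.instance Definition _ := gen_choiceMixin condition.

Lemma cond_ext (p q : condition) : (forall i, p i = q i) -> p = q.
Proof.
case: p q => [p pfin pinh] [q qfin qinh] /= pq.
have {}pq : p = q by exact: functional_extensionality_dep.
by case: q / pq qfin => qfin; congr Condition; exact: Prop_irrelevance.
Qed.

Definition cond_le (q p : condition) : bool :=
  `[< forall i x, p i = Some x -> exists2 y, q i = Some y & y <= x >].

Lemma cond_le_refl : reflexive cond_le.
Proof. by move=> p; apply/asboolP => i x pi; exists x. Qed.

Lemma cond_le_anti : antisymmetric cond_le.
Proof.
move=> p q /andP[/asboolP pq /asboolP qp]; apply: cond_ext => i.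
case pi: (p i) => [x|]; last first.
  by case qi: (q i) => [y|//]; have [? ] := pq _ _ qi; rewrite pi.
have [y qi yx] := qp _ _ pi; have [z + zy] := pq _ _ qi.
by rewrite pi qi => -[xz]; congr Some; apply/le_anti; rewrite yx xz zy.
Qed.

Lemma cond_le_trans : transitive cond_le.
Proof.
move=> q p r /asboolP pq /asboolP qr; apply/asboolP => i x ri.
have [y qi yx] := qr _ _ ri; have [z pi zy] := pq _ _ qi.
by exists z => //; exact: le_trans zy yx.
Qed.

HB.instance Definition _ := Order.Le_isPOrder.Build (Order.Disp tt tt) condition
  cond_le_refl cond_le_anti cond_le_trans.

Lemma cond_leP (q p : condition) :
  q <= p <-> forall i x, p i = Some x -> exists2 y, q i = Some y & y <= x.
Proof. by split=> [/asboolP|H]; [|apply/asboolP]. Qed.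

Definition single_fun i (x : P i) : forall j, option (P j) :=
  dfwith (fun=> None) i (Some x).

Lemma single_fin i (x : P i) : finite_set [set j | single_fun x j].
Proof.
apply: (sub_finite_set _ (finite_set1 i)) => j /=.
by rewrite /single_fun; case: dfwithP.
Qed.

Definition single (inh : forall i, inhabited (P i)) i (x : P i) : condition :=
  Condition (single_fin x) inh.

(** * Boxes and slices *)

Definition box (F : forall i, set (P i)) : set condition :=
  [set q | forall i x, q i = Some x -> F i x].

Definition slice (G : set condition) i : set (P i) :=
  [set x | exists2 q, G q & q i = Some x].
Arguments slice : clear implicits.

Lemma sub_box (F H : forall i, set (P i)) :
  (forall i, F i `<=` H i) -> box F `<=` box H.
Proof. by move=> FH q Fq i x /Fq /FH. Qed.

Lemma sub_slice (G H : set condition) i : G `<=` H -> slice G i `<=` slice H i.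
Proof. by move=> GH x [q /GH]; exists q. Qed.

Lemma sub_box_slice (G : set condition) : G `<=` box (slice G).
Proof. by move=> q Gq i x qi; exists q. Qed.

Lemma single_box (F : forall i, set (P i)) inh i (x : P i) :
  F i x -> box F (single inh x).
Proof.
move=> Fx j /=; rewrite /single_fun.
by case: dfwithP => [|k _] y // -[<-].
Qed.

Lemma box_filter (F : forall i, set (P i)) :
  (forall i, poset_filter (F i)) -> poset_filter (box F).
Proof.
move=> Ffilter.
have inh i : inhabited (P i) by have [[x _] _ _] := Ffilter i.
split.
- have fin0 : finite_set [set i : I | (None : option (P i))].
    by apply: sub_finite_set (finite_set0 _) => i.
  by exists (Condition fin0 inh).
- move=> p q Fp Fq.
  (* A common refinement of [p] and [q] is chosen coordinate by coordinate; the last clause keeps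
     its domain inside the union of theirs, hence finite. *)
  have H i : exists r : option (P i),
      [/\ forall x, r = Some x -> F i x,
          forall x, p i = Some x -> exists2 y, r = Some y & y <= x,
          forall x, q i = Some x -> exists2 y, r = Some y & y <= x
        & r -> p i || q i].
    have [_ Fdir _] := Ffilter i.
    case pi: (p i) => [x|]; case qi: (q i) => [y|].
    + have [z [Fz zx zy]] := Fdir _ _ (Fp _ _ pi) (Fq _ _ qi).
      by exists (Some z); split=> // _ [<-] //; exists z.
    + exists (Some x); split=> // _ [<-]; first exact: Fp.
      by exists x.
    + exists (Some y); split=> // _ [<-]; first exact: Fq.
      by exists y.
    + by exists None; split.
  have [r rP] := all_sig (fun i => cid (H i)).
  have rfin : finite_set [set i | r i].
    have : finite_set ([set i | p i] `|` [set i | q i]).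
      by rewrite finite_setU; split; exact: cond_fin.
    by apply: sub_finite_set => i /=; have [_ _ _ /[apply] /orP] := rP i.
  exists (Condition rfin inh); split.
  + by move=> i; have [] := rP i.
  + by apply/cond_leP => i; have [] := rP i.
  + by apply/cond_leP => i; have [] := rP i.
- move=> p q Fp /cond_leP pq i x /pq[y /Fp Fy yx].
  by have [_ _ Fup] := Ffilter i; exact: Fup Fy yx.
Qed.

Lemma slice_filter (G : set condition) i :
  poset_filter G -> slice G i !=set0 -> poset_filter (slice G i).
Proof.
move=> [_ Gdir Gup] nonempty; split=> //.
- move=> x y [p Gp pi] [q Gq qi].
  have [r [Gr /cond_leP rp /cond_leP rq]] := Gdir _ _ Gp Gq.
  have [z ri zx] := rp _ _ pi; have [z' + zy] := rq _ _ qi.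
  by rewrite ri => -[zz']; exists z; split=> //; [exists r|rewrite zz'].
(* The one-coordinate condition with value [y] lies above [q], since [q i] is [x] and [x <= y]. *)
- move=> x y [q Gq qi] xy; exists (single (cond_inh q) y); last exact: dfwithin.
  apply: Gup Gq _; apply/cond_leP => j /=.
  rewrite /single_fun; case: dfwithP => [|k _] z // -[<-].
  by exists x.
Qed.

Lemma slice_box (F : forall i, set (P i)) i :
  (forall i, poset_filter (F i)) -> slice (box F) i = F i.
Proof.
move=> Ffilter; apply/seteqP; split=> [x [q]|x Fx]; first exact.
have inh j : inhabited (P j) by have [[y _] _ _] := Ffilter j.
by exists (single inh x); [exact: single_box|exact: dfwithin].
Qed.

(** If a filter [G] contains [box F], its slices contain the [F i], hence equal them by maximality;
    as [G] lies in the box of its slices, it lies in [box F]. *)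
Lemma maximal_box (F : forall i, set (P i)) :
  (forall i, maximal_filter (F i)) -> maximal_filter (box F).
Proof.
move=> Fmax; have Ffilter i : poset_filter (F i) by have [] := Fmax i.
split=> [|G Gfilter [FG GNF]]; first exact: box_filter.
apply: GNF => q /sub_box_slice; apply: sub_box => i.
have FGi : F i `<=` slice G i by rewrite -(slice_box i Ffilter); exact: sub_slice.
rewrite -(@maximal_filter_eq _ _ (F i) (slice G i))//.
apply: slice_filter => //.
by have [[x Fx] _ _] := Ffilter i; exists x; exact: FGi.
Qed.

(** Enlarging the slices of a maximal [G] to filters never enlarges [G]. Each fact below about the
    slices of [G] comes from a suitable choice of [H]. *)
Lemma maximal_box_eq (G : set condition) (H : forall i, set (P i)) :
  maximal_filter G -> (forall i, poset_filter (H i)) ->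
  (forall i, slice G i `<=` H i) -> G = box H.
Proof.
move=> Gmax Hfilter GH; apply: maximal_filter_eq => //; first exact: box_filter.
by apply: subset_trans (sub_box GH); exact: sub_box_slice.
Qed.

Lemma maximal_slice_filter (G : set condition) i :
  maximal_filter G -> poset_filter (slice G i).
Proof.
move=> Gmax; have [Gfilter _] := Gmax; have [[q _] _ _] := Gfilter.
(* Nonempty slices are kept and empty ones become principal filters. Then [G] is the box of the
   result, so its slices are the chosen filters, with no separate refutation of emptiness. *)
have H j : exists H : set (P j), poset_filter H /\ slice G j `<=` H.
  have [->|/set0P Gj] := eqVneq (slice G j) set0; last first.
    by exists (slice G j); split=> //; exact: slice_filter.
  have [x] := cond_inh q j.
  by exists [set y | x <= y]; split; [exact: principal_filter|exact: sub0set].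
have [H' /all_and2[H'filter GH']] := all_sig (fun i => cid (H i)).
by rewrite (maximal_box_eq Gmax H'filter GH') slice_box.
Qed.

Lemma box_sliceK (G : set condition) : maximal_filter G -> box (slice G) = G.
Proof.
move=> Gmax; apply/esym/maximal_box_eq => // i; last exact: subset_refl.
exact: maximal_slice_filter.
Qed.

Lemma maximal_slice (G : set condition) i :
  maximal_filter G -> maximal_filter (slice G i).
Proof.
move=> Gmax; split=> [|K Kfilter [GK KNG]]; first exact: maximal_slice_filter.
(* Only the slice at [i] is enlarged, to [K]; since [G] is still the box of [H], its slice at [i] is
   already [K]. *)
pose H := dfwith (slice G) i K.
have Hfilter j : poset_filter (H j).
  by rewrite /H; case: dfwithP => // k _; exact: maximal_slice_filter.
have GH : G = box H.
  apply: maximal_box_eq => // j; rewrite /H; case: dfwithP => // k _.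
  exact: subset_refl.
by apply: KNG; rewrite GH slice_box// /H dfwithin.
Qed.

(** * The homeomorphism *)

Local Notation product := (prod_topology (fun i : I => MF (P i))).

Definition MF_box (F : product) : MF condition :=
  MF_of (maximal_box (fun i => MF_filter (F i))).

Definition MF_slice (G : MF condition) : product :=
  fun i => MF_of (maximal_slice i (MF_filter G)).

Lemma MF_boxK : cancel MF_box MF_slice.
Proof.
move=> F; apply: functional_extensionality_dep => i; apply: MF_valK.
by apply: slice_box => j; have [] := MF_filter (F j).
Qed.

Lemma MF_sliceK : cancel MF_slice MF_box.
Proof. by move=> G; apply: MF_valK; exact: box_sliceK (MF_filter G). Qed.

Lemma continuous_MF_box : continuous MF_box.
Proof.
move=> F A /nbhs_MF[q Fq qA].
(* The preimage of [MF_nbr q] is the intersection of the [B i]. Off the finite domain of [q], [B i]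
   is the whole product, so finitely many cylinders suffice. *)
pose B i := [set F' : product | forall x, q i = Some x -> set_val (F' i) x].
have qfin := cond_fin q.
have : nbhs F (\bigcap_(i in [set` fset_set [set i | q i]]) B i).
  apply: filter_bigI => i _; rewrite /B.
  case qi: (q i) => [x|]; last by apply: filterS filterT.
  have : nbhs F [set F' : product | MF_nbr x (F' i)].
    apply: (@proj_continuous I (fun i => MF (P i)) i F).
    by apply: open_nbhs_nbhs; split; [exact: open_MF_nbr|exact: Fq].
  by apply: filterS => F' F'x _ [<-].
apply: filterS => F' BF'; apply: qA => i x qi; apply: (BF' i) => //=.
by rewrite in_fset_set// inE /= qi.
Qed.

Lemma continuous_MF_slice : continuous MF_slice.
Proof.
move=> G.
have FF : Filter (MF_slice @ G) by apply: fmap_filter; exact: nbhs_filter.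
(* The product topology is the supremum of those induced by the projections, so one coordinate [i]
   is treated at a time. *)
apply/cvg_sup => i U [V [[A Aopen <-] /= AGi] AU]; apply: filterS AU _.
(* Any maximal filter containing [q] has [x] in its slice at [i], so [MF_nbr q] is the required
   neighbourhood of [G]. *)
have /nbhs_MF[x [q Gq qi] xA] : nbhs (MF_slice G i) A by exact: open_nbhs_nbhs.
have : nbhs G (MF_nbr q) by apply: open_nbhs_nbhs; split=> //; exact: open_MF_nbr.
by apply: filterS => G' G'q; apply: xA; exists q.
Qed.

End FiniteConditions.

Theorem theorem4p1 (I : Type) (d : I -> Order.disp_t)
    (P : forall i : I, porderType (d i)) :
  exists (d' : Order.disp_t) (Q : porderType d'),
    homeomorphic (prod_topology (fun i : I => MF (P i))) (MF Q).
Proof.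
(* [I] is a bare type; [{classic I}] is the same type with the classical equality and choice that
   conditions require. *)
exists _, (@condition {classic I} d P).
exists (@MF_box {classic I} d P), (@MF_slice {classic I} d P).
split; [exact: MF_boxK|exact: MF_sliceK| |].
  exact: (@continuous_MF_box {classic I} d P).
exact: (@continuous_MF_slice {classic I} d P).
Qed.
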